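(* There is a universal constant $c>0$ such that the following holds. Let $m>0$ be an integer. There exists a family $\mathcal{J}$ of interaction matrices (of some dimension $n\times n$) of cardinality $|\mathcal{J}|=m$ that satisfies $\sup_{J\in\mathcal{J}}\|J\|_\infty\le1/2$, such that for any one-sample estimator $\hat J=\hat J(x)$, $$\max_{J^*\in\mathcal{J}}\mathbb{E}_{x\sim\Pr_{J^*}}\big[\|\hat J(x)-J^*\|_F\big]\ge c\sqrt{\log m}.$$
   Context: An interaction matrix is a real symmetric $n\times n$ matrix $J$ with zero diagonal. The Ising model $\Pr_J$ is the distribution on $\{\pm1\}^n$ with $\Pr_J[x]\propto\exp(x^\top Jx/2)$. $\|J\|_\infty=\max_i\sum_j|J_{ij}|$ and $\|\cdot\|_F$ is the Frobenius norm. A one-sample estimator is any function from $\{\pm1\}^n$ to $\mathbb{R}^{n\times n}$. *)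

(* Defs.v *)
From HB Require Import structures.
From mathcomp Require Import all_boot all_order all_algebra.
From mathcomp Require Import finmap.
From mathcomp Require Import all_classical all_reals all_analysis.
Set Implicit Arguments.
Unset Strict Implicit.
Unset Printing Implicit Defensive.
Import Order.TTheory GRing.Theory Num.Theory.
Local Open Scope ring_scope.

(* Points of {-1,+1}^n are encoded by Boolean vectors; [true] is the spin -1. *)
Definition config (n : nat) : finType := {ffun 'I_n -> bool}.

Definition spin (R : realType) (n : nat) (x : config n) : 'cV[R]_n :=
  \col_i (-1) ^+ (x i).

Definition interaction_matrix (R : realType) (n : nat) (J : 'M[R]_n) : Prop :=
  J^T = J /\ forall i : 'I_n, J i i = 0.

Definition ising_weight (R : realType) (n : nat) (J : 'M[R]_n)
    (x : config n) : R :=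
  expR (((spin R x)^T *m J *m spin R x) 0 0 / 2%:R).

Definition ising_prob (R : realType) (n : nat) (J : 'M[R]_n)
    (x : config n) : R :=
  ising_weight J x / \sum_(y : config n) ising_weight J y.

Definition ising_expectation (R : realType) (n : nat) (J : 'M[R]_n)
    (f : config n -> R) : R :=
  \sum_(x : config n) ising_prob J x * f x.

(* The default value 0 is harmless here and below: the row sums, the norms and
   the risks over which maxima are taken are nonnegative. *)
Definition mx_infnorm (R : realType) (n : nat) (J : 'M[R]_n) : R :=
  \big[Num.max/0]_(i < n) \sum_(j < n) `|J i j|.

Definition mx_frobenius (R : realType) (n : nat) (A : 'M[R]_n) : R :=
  Num.sqrt (\sum_(i < n) \sum_(j < n) (A i j) ^+ 2).

Definition frobenius_risk (R : realType) (n : nat)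
    (Jhat : config n -> 'M[R]_n) (J : 'M[R]_n) : R :=
  ising_expectation J (fun x => mx_frobenius (Jhat x - J)).

(* Main.v *)
Require Import Defs.
From HB Require Import structures.
From mathcomp Require Import all_boot all_order all_algebra.
From mathcomp Require Import finmap.
From mathcomp Require Import all_classical all_reals all_analysis.
From mathcomp Require Import ring lra.
Set Implicit Arguments.
Unset Strict Implicit.
Unset Printing Implicit Defensive.
Import Order.TTheory GRing.Theory Num.Theory.
Local Open Scope ring_scope.

(** Group the spins into disjoint pairs and let the only couplings be those
inside the pairs, each equal to 0 or 1/2.  Such a matching matrix has row sums
at most 1/2, so the strength of the interaction does not grow with the number
of pairs, and one sample carries only a bounded amount of information about
each coupling: changing one of them moves the matrix by at most 1 in entrywise
l1 norm, hence changes every probability by a factor at most e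
([ising_prob_le]).  With [k] free couplings, an estimator therefore makes an
expected error of constant order on each of them, and [k] errors of constant
order add up to a Frobenius error of order [sqrt k], while the family has
[2 ^ k] members.

This is Assouad's method ([ising_assouad]).  Averaging over the hypercube of
couplings, each member is paired with the one that differs from it on a given
edge of the matching; the two-point bound [ising_expectation_two_point] then
forces the error on that edge, and Cauchy-Schwarz ([sum_edges_le_frobenius])
turns the sum of the errors over the edges into a lower bound for the Frobenius
norm.

A cardinality [m] need not be a power of two.  With [2 ^ k <= m < 2 ^ k.+1],
one takes [k.+1] pairs and any [m] of the [2 ^ k.+1] coupling vectors that
include the [2 ^ k] ones with a fixed coupling on the first pair: the maximal
risk only increases with the family, and [ln m] is at most [4 * k], also for
[m = 1], where both vanish. *)

(** * Finite sets and finite sums *)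

Lemma exists_superset_card (T : finType) (A : {set T}) (m : nat) :
  (#|A| <= m <= #|T|)%N -> exists B : {set T}, A \subset B /\ #|B| = m.
Proof.
move=> /andP[Am mT].
pose B := A :|: [set x in take (m - #|A|) (enum (~: A))].
exists B; split; first exact: finset.subsetUl.
have dAB : A :&: [set x in take (m - #|A|) (enum (~: A))] = finset.set0.
  apply/finset.setP => x; rewrite !inE.
  apply/negbTE/negP => /andP[xA] /mem_take.
  by rewrite mem_enum !inE xA.
rewrite cardsU dAB cards0 subn0 cardsE.
have /card_uniqP -> : uniq (take (m - #|A|) (enum (~: A))).
  exact/take_uniq/enum_uniq.
rewrite size_takel; first by rewrite subnKC.
by rewrite -cardE leq_subLR cardsC.
Qed.

(** The Cauchy-Schwarz inequality against the constant vector, from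
[y i * y j <= (y i ^+ 2 + y j ^+ 2) / 2]. *)
Lemma sqr_sum_le (R : realType) (k : nat) (y : 'I_k -> R) :
  (\sum_j y j) ^+ 2 <= k%:R * \sum_j (y j) ^+ 2.
Proof.
have -> : k%:R * \sum_j (y j) ^+ 2
    = \sum_(i < k) \sum_(j < k) ((y i) ^+ 2 / 2 + (y j) ^+ 2 / 2).
  under [RHS]eq_bigr do rewrite big_split /= sumr_const card_ord -mulr_suml.
  rewrite big_split /= sumr_const card_ord sumrMnl -mulr_suml -mulr_natl.
  by field.
rewrite expr2 big_distrlr /=.
apply: ler_sum => i _; apply: ler_sum => j _.
rewrite -subr_ge0 (_ : _ - _ = (y i - y j) ^+ 2 / 2); last by field.
by rewrite divr_ge0 ?sqr_ge0.
Qed.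

(** * Stability of the Ising model under perturbation of the couplings *)

Section IsingPerturbation.
Variables (R : realType) (n : nat).
Implicit Types (J : 'M[R]_n) (x : config n).

Definition mx_l1norm J : R := \sum_i \sum_j `|J i j|.

Lemma mx_l1normB J J' : mx_l1norm (J - J') = mx_l1norm (J' - J).
Proof.
by apply: eq_bigr => i _; apply: eq_bigr => j _; rewrite !mxE distrC.
Qed.

(** Spins have modulus 1, so each entry of the matrix contributes at most its
absolute value. *)
Lemma quad_form_le J x :
  ((spin R x)^T *m J *m spin R x) 0 0 <= mx_l1norm J.
Proof.
rewrite mxE /mx_l1norm exchange_big /=; apply: ler_sum => j _.
rewrite !mxE mulr_suml; apply: ler_sum => i _.
rewrite !mxE (le_trans (ler_norm _))//.
by rewrite !normrM !normrX !normrN1 !expr1n mul1r mulr1.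
Qed.

Lemma ising_weight_gt0 J x : 0 < ising_weight J x.
Proof. exact: expR_gt0. Qed.

Lemma ising_partition_gt0 J : 0 < \sum_(y : config n) ising_weight J y.
Proof.
rewrite (bigD1 [ffun=> false])//= ltr_pwDl ?ising_weight_gt0//.
by apply: sumr_ge0 => y _; exact/ltW/ising_weight_gt0.
Qed.

Lemma ising_prob_ge0 J x : 0 <= ising_prob J x.
Proof.
by rewrite divr_ge0// ltW// ?ising_weight_gt0// ising_partition_gt0.
Qed.

Lemma sum_ising_prob J : \sum_x ising_prob J x = 1.
Proof. by rewrite -mulr_suml divff// gt_eqF// ising_partition_gt0. Qed.

(** The exponents for [J] and [J'] differ by half the quadratic form of
[J - J']. *)
Lemma ising_weight_le J J' x :
  ising_weight J x <= expR (mx_l1norm (J - J') / 2) * ising_weight J' x.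
Proof.
rewrite /ising_weight -expRD ler_expR -mulrDl ler_pM2r ?invr_gt0//.
rewrite -lerBlDr (le_trans _ (quad_form_le _ x))//.
by rewrite mulmxBr mulmxBl [leRHS]mxE [X in _ <= _ + X]mxE.
Qed.

(** Half of the exponent comes from the weight of [x] and half from the
partition function, which is a sum of weights. *)
Lemma ising_prob_le J J' x :
  ising_prob J x <= expR (mx_l1norm (J - J')) * ising_prob J' x.
Proof.
set D := mx_l1norm _.
have DE : expR D = expR (D / 2) * expR (D / 2) by rewrite -expRD -splitr.
rewrite ler_pdivrMr ?ising_partition_gt0//.
apply: (le_trans (ising_weight_le J J' x)).
rewrite -/D DE /ising_prob -!mulrA ler_pM2l ?expR_gt0//.
rewrite [leRHS]mulrCA ler_peMr ?(ltW (ising_weight_gt0 _ _))//.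
rewrite mulrCA ler_pdivlMl ?ising_partition_gt0// mulr1 mulr_sumr.
by apply: ler_sum => y _; rewrite /D mx_l1normB ising_weight_le.
Qed.

End IsingPerturbation.

(** * Matching matrices *)

Section Matching.
Variables (R : realType) (k : nat).
Implicit Types v w : 'rV[R]_k.

(** The vertex [lshift k i] is matched with [rshift k i], with coupling
[v 0 i]. *)
Definition matching_mx v : 'M[R]_(k + k) :=
  block_mx 0 (diag_mx v) (diag_mx v) 0.

Lemma matching_mxB v w : matching_mx (v - w) = matching_mx v - matching_mx w.
Proof.
by rewrite /matching_mx opp_block_mx add_block_mx !oppr0 !addr0 linearB.
Qed.

Lemma matching_mx_edge v i : matching_mx v (lshift k i) (rshift k i) = v 0 i.
Proof. by rewrite block_mxEur mxE eqxx. Qed.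

Lemma matching_mx_inj : injective matching_mx.
Proof.
move=> v w vw; apply/rowP => i.
by rewrite -[LHS]matching_mx_edge vw matching_mx_edge.
Qed.

Lemma matching_mx_interaction v : interaction_matrix (matching_mx v).
Proof.
split; first by rewrite tr_block_mx !tr_diag_mx !trmx0.
by move=> i; case: (split_ordP i) => j ->;
  rewrite ?block_mxEul ?block_mxEdr mxE.
Qed.

Lemma sum_norm_diag_mx v i : \sum_j `|diag_mx v i j| = `|v 0 i|.
Proof.
rewrite (bigD1 i)//= mxE eqxx big1 ?addr0// => j ji.
by rewrite mxE eq_sym (negbTE ji) normr0.
Qed.

Lemma matching_mx_row v (i : 'I_k) :
  (\sum_j `|matching_mx v (lshift k i) j| = `|v 0 i|) *
  (\sum_j `|matching_mx v (rshift k i) j| = `|v 0 i|).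
Proof.
split; rewrite big_split_ord /=.
- rewrite big1 ?add0r => [|j _]; last by rewrite block_mxEul mxE normr0.
  by under eq_bigr do rewrite block_mxEur; exact: sum_norm_diag_mx.
- rewrite [X in _ + X]big1 ?addr0 => [|j _]; last first.
    by rewrite block_mxEdr mxE normr0.
  by under eq_bigr do rewrite block_mxEdl; exact: sum_norm_diag_mx.
Qed.

Lemma matching_mx_infnorm_le v (a : R) :
  0 <= a -> (forall i, `|v 0 i| <= a) -> mx_infnorm (matching_mx v) <= a.
Proof.
move=> a0 va; apply: bigmax_le => // i _.
by case: (split_ordP i) => j ->; rewrite matching_mx_row.
Qed.

Lemma matching_mx_l1norm v : mx_l1norm (matching_mx v) = 2 * \sum_i `|v 0 i|.
Proof.
rewrite /mx_l1norm big_split_ord /=.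
under eq_bigr do rewrite matching_mx_row.
under [X in _ + X]eq_bigr do rewrite matching_mx_row.
by rewrite mulrDl mul1r.
Qed.

End Matching.

(** * Assouad's method for one sample *)

(** Cauchy-Schwarz on the entries [(a j, b j)].  Injectivity of [a] makes these
entries lie in different rows, so that their squares are counted once in the
Frobenius norm. *)
Lemma sum_edges_le_frobenius (R : realType) (n k : nat) (a b : 'I_k -> 'I_n)
    (M : 'M[R]_n) :
  injective a ->
  \sum_j `|M (a j) (b j)| <= Num.sqrt k%:R * mx_frobenius M.
Proof.
move=> ainj; rewrite -sqrtrM ?ler0n// -[leLHS]ger0_norm ?sumr_ge0//.
rewrite -sqrtr_sqr ler_sqrt ?mulr_ge0 ?ler0n ?sumr_ge0//; last first.
  by move=> i _; apply: sumr_ge0 => j _; exact: sqr_ge0.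
apply: (le_trans (sqr_sum_le _)); rewrite ler_wpM2l ?ler0n//.
apply: (@le_trans _ _ (\sum_(j < k) \sum_l M (a j) l ^+ 2)).
  apply: ler_sum => j _; rewrite (bigD1 (b j))//= real_normK ?num_real//.
  by rewrite lerDl sumr_ge0// => l _; exact: sqr_ge0.
have -> : \sum_j \sum_l M (a j) l ^+ 2
    = \sum_(i in a @: finset.setT) \sum_l M i l ^+ 2.
  rewrite big_imset /=; last by move=> i j _ _; exact: ainj.
  by apply: eq_bigl => j; rewrite inE.
rewrite [leRHS](bigID (mem (a @: finset.setT))) /= lerDl sumr_ge0// => i _.
by apply: sumr_ge0 => l _; exact: sqr_ge0.
Qed.

(** Le Cam's two-point argument: [J'] gives each configuration at least
[expR (- mx_l1norm (J - J'))] times its mass under [J], and under the latter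
mass [g + h] averages to at least [a]. *)
Lemma ising_expectation_two_point (R : realType) (n : nat) (J J' : 'M[R]_n)
    (g h : config n -> R) (a : R) :
  (forall x, 0 <= g x) -> (forall x, 0 <= h x) -> (forall x, a <= g x + h x) ->
  expR (- mx_l1norm (J - J')) * a
    <= ising_expectation J g + ising_expectation J' h.
Proof.
move=> g0 h0 agh; set e := expR _.
have e0 : 0 <= e by exact: expR_ge0.
have e1 : e <= 1.
  rewrite -expR0 ler_expR oppr_le0.
  by apply: sumr_ge0 => i _; apply: sumr_ge0.
rewrite -[a]mul1r -(sum_ising_prob J) mulr_suml mulr_sumr -big_split /=.
apply: ler_sum => x _.
have P0 := ising_prob_ge0 J x.
have P0' : e * ising_prob J x <= ising_prob J' x.
  rewrite /e expRN ler_pdivrMl ?expR_gt0//.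
  exact: ising_prob_le.
apply: (@le_trans _ _ (e * ising_prob J x * (g x + h x))).
  by rewrite -mulrA ler_wpM2l// ler_wpM2l.
rewrite mulrDr lerD// ler_wpM2r//.
by rewrite ler_piMl.
Qed.

Definition flip (k : nat) (j : 'I_k) (f : {ffun 'I_k -> bool}) :
  {ffun 'I_k -> bool} := [ffun i => f i (+) (i == j)].

Lemma flipK (k : nat) (j : 'I_k) : involutive (flip j).
Proof. by move=> f; apply/ffunP => i; rewrite !ffunE addbK. Qed.

(** If flipping any bit [j] moves the entry [(a j, b j)] by at least [d], the
triangle inequality prevents an estimate from being close to both values, and
closeness in l1 norm prevents the sample from telling them apart.  Reindexing
the average over [f] along [flip j] pairs the two cases. *)
Lemma ising_assouad (R : realType) (n k : nat)
    (J : {ffun 'I_k -> bool} -> 'M[R]_n) (a b : 'I_k -> 'I_n) (d D : R)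
    (Jhat : config n -> 'M[R]_n) :
  injective a -> 0 <= d ->
  (forall f j, d <= `|J f (a j) (b j) - J (flip j f) (a j) (b j)|) ->
  (forall f j, mx_l1norm (J f - J (flip j f)) <= D) ->
  exists f, expR (- D) * d / 2 * Num.sqrt k%:R <= frobenius_risk Jhat (J f).
Proof.
move=> ainj d0 sep close; set c := _ * d / 2.
pose err f j x := `|Jhat x (a j) (b j) - J f (a j) (b j)|.
have edge_bound j :
    c *+ #|{ffun 'I_k -> bool}| <= \sum_f ising_expectation (J f) (err f j).
  rewrite -(ler_pM2r (ltr0n R 2)) -sumr_const [leRHS]mulr_natr mulr2n.
  rewrite [X in _ <= _ + X](reindex_inj (inv_inj (flipK j))).
  rewrite -big_split mulr_suml.
  apply: ler_sum => f _ /=; rewrite /c divfK ?pnatr_eq0//.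
  apply: (le_trans _ (@ising_expectation_two_point _ _ (J f) (J (flip j f))
    (err f j) (err (flip j f) j) d _ _ _)).
  - by rewrite ler_wpM2r// ler_expR lerN2.
  - by move=> x; exact: normr_ge0.
  - by move=> x; exact: normr_ge0.
  - move=> x; apply: (le_trans (sep f j)); rewrite /err [X in _ <= X + _]distrC.
    exact: ler_distD.
have risk_bound f :
    \sum_j ising_expectation (J f) (err f j)
      <= Num.sqrt k%:R * frobenius_risk Jhat (J f).
  rewrite exchange_big mulr_sumr; apply: ler_sum => x _ /=.
  rewrite -mulr_sumr mulrCA ler_wpM2l ?ising_prob_ge0//.
  apply: le_trans (sum_edges_le_frobenius b _ ainj).
  by apply: ler_sum => j _; rewrite !mxE.
have [/existsP[f]|] :=
    boolP [exists f, k%:R * c <= Num.sqrt k%:R * frobenius_risk Jhat (J f)].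
  move=> kc; exists f; have [k0|k0] := posnP k.
    rewrite k0 sqrtr0 mulr0 sumr_ge0// => x _.
    by rewrite mulr_ge0 ?ising_prob_ge0 ?sqrtr_ge0.
  rewrite -(ler_pM2l (_ : 0 < Num.sqrt k%:R :> R)) ?sqrtr_gt0 ?ltr0n//.
  by rewrite mulrCA -expr2 sqr_sqrtr ?ler0n// mulrC.
(* Otherwise summing over the hypercube contradicts the edge bounds. *)
rewrite negb_exists => /forallP small; exfalso.
suff : \sum_(f : {ffun 'I_k -> bool}) k%:R * c
    < \sum_(f : {ffun 'I_k -> bool}) k%:R * c by rewrite ltxx.
have : \sum_f Num.sqrt k%:R * frobenius_risk Jhat (J f)
    < \sum_(f : {ffun 'I_k -> bool}) k%:R * c.
  apply: ltr_sum => [|f _]; last by rewrite ltNge small.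
  by apply/hasP; exists [ffun=> false] => //; rewrite mem_index_enum.
apply: le_lt_trans; apply: le_trans (ler_sum _ (fun f _ => risk_bound f)).
have -> : \sum_(f : {ffun 'I_k -> bool}) k%:R * c
    = \sum_(j < k) c *+ #|{ffun 'I_k -> bool}|.
  by rewrite !sumr_const card_ord mulr_natl mulrnAC.
rewrite exchange_big /=.
by apply: ler_sum => j _; exact: edge_bound.
Qed.

(** * The family of matchings *)

(** The hypercube of the lower bound is formed by [t.2]; the bit [t.1], carried
by the first pair, makes room for the members beyond a power of two. *)
Definition couplings (R : realType) (k : nat) (t : bool * {ffun 'I_k -> bool}) :
    'rV[R]_k.+1 :=
  \row_i (((if unlift ord0 i is Some j then t.2 j else t.1) : bool)%:R / 2).

Lemma couplings_lift (R : realType) (k : nat) t (j : 'I_k) :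
  couplings R t 0 (lift ord0 j) = (t.2 j)%:R / 2.
Proof. by rewrite mxE liftK. Qed.

Lemma couplings_inj (R : realType) (k : nat) : injective (@couplings R k).
Proof.
have half_inj : injective (fun b : bool => b%:R / 2 : R).
  by move=> [] [] //= H; exfalso; move: H; lra.
move=> [b f] [b' f'] /rowP E; congr (_, _).
  by have := E ord0; rewrite !mxE unlift_none => /half_inj.
by apply/ffunP => j; have := E (lift ord0 j);
  rewrite !couplings_lift => /half_inj.
Qed.

Lemma couplings_norm_le (R : realType) (k : nat) t i :
  `|@couplings R k t 0 i| <= 1 / 2.
Proof.
by rewrite mxE normrM normfV !normr_nat ler_pM2r ?invr_gt0// lern1 leq_b1.
Qed.

Lemma couplings_flip (R : realType) (k : nat) b (f : {ffun 'I_k -> bool}) j i :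
  `|(couplings R (b, f) - couplings R (b, flip j f)) 0 i|
    = (i == lift ord0 j)%:R / 2.
Proof.
rewrite !mxE; case: unliftP => [l|] -> /=; last by rewrite subrr normr0 mul0r.
rewrite ffunE (inj_eq lift_inj) -mulrBl normrM normfV normr_nat; congr (_ / _).
case: (l == j); case: (f l);
  by rewrite /= ?subrr ?subr0 ?sub0r ?normrN ?normr1 ?normr0.
Qed.

Theorem corollary9 (R : realType) :
  exists c : R, 0 < c /\
    forall m : nat, (0 < m)%N ->
      exists n : nat, (0 < n)%N /\
        exists Js : {fset 'M[R]_n},
          [/\ #|` Js| = m,
              forall J : 'M[R]_n, J \in Js -> interaction_matrix J,
              \big[Num.max/0]_(J <- Js) mx_infnorm J <= 1 / 2%:R &
              forall Jhat : config n -> 'M[R]_n,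
                c * Num.sqrt (ln m%:R)
                  <= \big[Num.max/0]_(J <- Js) frobenius_risk Jhat J].
Proof.
(* [ising_assouad] yields [expR (- 1) / 4 * sqrt k], flips having l1 size 1 and
   entry size 1/2; the other factor 2 is lost in [sqrt (ln m) <= 2 * sqrt k]. *)
exists (expR (-1) / 8); split; first by rewrite divr_gt0 ?expR_gt0.
move=> m m0; pose k := trunc_log 2 m; exists (k.+1 + k.+1)%N; split=> //.
have /andP[km mk] := trunc_log_bounds (isT : (1 < 2)%N) m0.
pose T : finType := (bool * {ffun 'I_k -> bool})%type.
pose J (t : T) := matching_mx (couplings R t).
have Jinj : injective J by move=> t t' /matching_mx_inj /couplings_inj.
have [B [/fintype.subsetP hardB Bm]] : exists B : {set T},
    [set (false, f) | f : {ffun 'I_k -> bool}] \subset B /\ #|B| = m.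
  apply: exists_superset_card; apply/andP; split.
    by apply: (leq_trans (leq_imset_card _ _));
      rewrite card_ffun card_bool card_ord.
  by rewrite card_prod card_ffun card_bool card_ord -expnS ltnW.
exists [fset J t | t in B]%fset; split.
- by rewrite card_imfset//= -Bm cardE.
- by move=> _ /imfsetP[t _ ->]; exact: matching_mx_interaction.
- rewrite big_seq; apply: bigmax_le => [|_ /imfsetP[t _ ->]]; first by lra.
  by apply: matching_mx_infnorm_le => [|i]; [lra|exact: couplings_norm_le].
move=> Jhat.
have [||||f] := @ising_assouad R _ k (fun f => J (false, f))
  (fun j => lshift k.+1 (lift ord0 j)) (fun j => rshift k.+1 (lift ord0 j))
  (1 / 2) 1 Jhat.
- by move=> i j /lshift_inj /lift_inj.
- by lra.
- move=> f j; rewrite !matching_mx_edge.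
  by have := couplings_flip R false f j (lift ord0 j);
    rewrite !mxE => ->; rewrite eqxx.
- move=> f j; rewrite -matching_mxB matching_mx_l1norm.
  under eq_bigr do rewrite couplings_flip.
  rewrite -mulr_suml (bigD1 (lift ord0 j))//= eqxx big1 => [|i /negbTE->//].
  by rewrite addr0 mul1r divff ?pnatr_eq0.
move=> Jf; apply: (@bigmax_sup_seq _ _ _ _ 0 (J (false, f))) => //.
  by apply: in_imfset; apply: hardB; apply: imset_f.
apply: le_trans Jf.
(* [m < 2 ^ k.+1 <= 4 ^ k] once [0 < k], and [m = 1] when [k = 0]. *)
have lnm : ln m%:R <= 2 ^+ 2 * k%:R :> R.
  have m4 : (m <= 4 ^ k)%N.
    move: mk; rewrite -/k; move: {km} (k) => [|l].
      by rewrite expn0 expn1 ltnS.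
    move=> mk; rewrite (leq_trans (ltnW mk))//.
    rewrite -[4%N]/(2 ^ 2)%N -expnM leq_exp2l//.
    by rewrite mulnS -add2n leq_add2l leq_pmull.
  apply: (@le_trans _ _ (ln ((4 ^ k)%:R))).
    by rewrite ler_ln ?posrE ?ltr0n ?expn_gt0// ler_nat.
  rewrite natrX lnXn ?ltr0n// -[leLHS]mulr_natr ler_wpM2r ?ler0n//.
  by rewrite -natrX; apply/ltW/ln_sublinear; rewrite ltr0n.
have : Num.sqrt (ln m%:R) <= 2 * Num.sqrt k%:R :> R.
  have -> : 2 * Num.sqrt k%:R = Num.sqrt (2 ^+ 2 * k%:R) :> R.
    by rewrite sqrtrM ?sqr_ge0// sqrtr_sqr ger0_norm.
  by rewrite ler_sqrt ?mulr_ge0 ?ler0n.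
have := expR_gt0 (-1 : R).
by nra.
Qed.
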